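(* For $l\ge5$ and $\nu=1,\dots,\lceil l/2\rceil-1$: \[t_{D_l,\lceil l/2\rceil-\nu}>t^+_{D_l,\lceil l/2\rceil+1-\nu}>t_{D_l,\lceil l/2\rceil+1-\nu}.\]
   Context: $f_{D_l}(t)=\sum_{j=0}^l(-1)^j\big(\binom lj\binom{l+j-1}{j}+\binom{l-2}{j-2}\binom{l+j-2}{j}\big)t^j$ (with $\binom ab=0$ for $b<0$) is the $f$-polynomial of the cluster complex of type $D_l$; it has $l$ simple roots in $(0,1)$, denoted $t_{D_l,1}>\cdots>t_{D_l,l}$. Let $f^+_{D_l}(t)=\sum_i c_i^+(-t)^i$, where $c_i^+$ is the number of $i$-vertex faces of the positive part (induced subcomplex on the positive roots) of the Fomin–Zelevinsky cluster complex of type $D_l$; equivalently (known) $f^+_{D_l}(t)=\frac{1}{(l-2)!}\frac{d^{l-3}}{dt^{l-3}}\big[t^{l-3}(1-t)^{l-2}\{(l-2)-(3l-4)t+(3l-4)t^2\}\big]$. It has $l$ simple real roots in $(0,1]$, including $t=1$; denote them $t^+_{D_l,1}>\cdots>t^+_{D_l,l}$. *)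

(* Defs.v *)
From mathcomp Require Import all_boot all_order all_algebra.
From mathcomp Require Import reals.
From mathcomp Require Import polyrcf.

Set Implicit Arguments.
Unset Strict Implicit.
Unset Printing Implicit Defensive.

Import GRing.Theory Num.Theory.
Local Open Scope ring_scope.

(* 'C(l - 2, j - 2) is guarded because the truncated j - 2 would give
   'C(l - 2, 0) = 1 for j < 2, where the intended binomial is 0. *)
Definition fD_coef (l j : nat) : nat :=
  ('C(l, j) * 'C(l + j - 1, j)
   + (if (2 <= j)%N then 'C(l - 2, j - 2) else 0) * 'C(l + j - 2, j))%N.

(* The f-polynomial, in -t, of the cluster complex of type D_l. *)
Definition fD (R : realType) (l : nat) : {poly R} :=
  \sum_(j < l.+1) ((-1) ^+ j * (fD_coef l j)%:R) *: 'X^j.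

(* The f-polynomial, in -t, of the positive part of the cluster complex of
   type D_l, given by its Rodrigues formula; meant for 3 <= l. *)
Definition fD_pos (R : realType) (l : nat) : {poly R} :=
  ((l - 2)`!%:R)^-1 *:
    ('X^(l - 3) * (1 - 'X) ^+ (l - 2)
     * ((l - 2)%:R%:P - (3 * l - 4)%:R *: 'X
        + (3 * l - 4)%:R *: 'X^2))^`(l - 3).

(* The k-th largest real root of p, counting from k = 1.  [rootsR p] is the
   strictly increasing list of all real roots of p; fD and fD_pos have degree l
   and l simple real roots, so for them no root is lost by listing each root
   once, and every 1 <= k <= l is a valid rank. *)
Definition nth_largest_root (R : realType) (p : {poly R}) (k : nat) : R :=
  nth 0 (rev (rootsR p)) k.-1.

Definition tD (R : realType) (l k : nat) : R := nth_largest_root (fD R l) k.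

Definition tD_pos (R : realType) (l k : nat) : R :=
  nth_largest_root (fD_pos R l) k.

(* Main.v *)
(* Put n = l - 1, let P be the shifted Legendre polynomial P_n(1 - 2t), and let
   w = (P_{n+1} - P_{n-1}) / (2(2n+1)), the primitive of -P vanishing at 0 and
   at 1.  Comparing coefficients,
     f_D   = (1 - 2t) P + (l - 2) w   and   f_D^+ = (1 - t)^2 P + (l t - 2) w.
   The roots r_i of P and w_i of w interlace,
     0 = w_0 < r_0 < w_1 < ... < r_{n-1} < w_n = 1,
   and P alternates in sign on the w_i, as w does on the r_i.  Evaluating the
   two identities at these points locates all roots: f_D^+ has one root in
   each ]w_i, w_{i+1}[ (and the root 1), and so does f_D in the gaps above 1/2.
   Hence only the order of the two roots in a common gap is in question; at a
   root t > 1/2 of f_D, eliminating P gives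
     (2t - 1) f_D^+ = w ((l - 2)(1 - t)^2 + (2t - 1)(l t - 2)),
   so f_D^+ has the sign of w there, opposite to its sign at the left end w_i
   of the gap: the root of f_D^+ comes first. *)
Require Import Defs.
From mathcomp Require Import all_boot all_order all_algebra.
From mathcomp Require Import reals polyrcf.
From mathcomp Require Import ring lra zify.

Set Implicit Arguments.
Unset Strict Implicit.
Unset Printing Implicit Defensive.

Import Order.TTheory GRing.Theory Num.Theory.
Local Open Scope ring_scope.

(** * Root counting by sign changes *)

Definition increasing_upto (R : realType) (k : nat) (a : nat -> R) : Prop :=
  forall i, (i.+1 < k)%N -> a i < a i.+1.

(** Since [f] is nonzero of degree at most [k], the [k] distinct values [b i] are all of its roots,
    and each is simple. *)
Definition all_simple_roots (R : realType) (f : {poly R}) (k : nat)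
    (b : nat -> R) : Prop :=
  [/\ f != 0, (size f <= k.+1)%N, increasing_upto k b
    & forall i, (i < k)%N -> root f (b i)].

(** For i <= k, the index [i] counts the values of [b] below [x]; i = 0 and i = k give the two
    unbounded gaps. *)
Definition in_gap (R : realType) (k : nat) (b : nat -> R) (i : nat) (x : R)
    : Prop :=
  (forall j, (j < i)%N -> b j < x)
  /\ (forall j, (i <= j)%N -> (j < k)%N -> x < b j).

Section RealRoots.

Context {R : realType}.
Implicit Types (f : {poly R}) (a b : nat -> R) (k i j : nat).

Lemma increasing_upto_lt k a i j :
  increasing_upto k a -> (i < j)%N -> (j < k)%N -> a i < a j.
Proof.
move=> inc; elim: j => // j IH; rewrite ltnS leq_eqVlt.
move=> /orP[/eqP->|lt_ij] ltk.
  exact: inc.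
by apply: lt_trans (inc _ ltk); apply: IH => //; apply: ltnW.
Qed.

Lemma increasing_upto_le k a i j :
  increasing_upto k a -> (i <= j)%N -> (j < k)%N -> a i <= a j.
Proof.
move=> inc; rewrite leq_eqVlt => /orP[/eqP->//|lt_ij] ltk.
exact: ltW (increasing_upto_lt inc lt_ij ltk).
Qed.

Lemma sorted_mkseq k a : increasing_upto k a -> sorted <%R (mkseq a k).
Proof.
move=> inc; apply/(sortedP 0) => i; rewrite size_mkseq => ltk.
by rewrite !nth_mkseq ?inc //; apply: ltnW.
Qed.

(** Both lists are strictly increasing, so equal membership suffices; a root outside [b] would give
    k + 1 roots, more than the degree allows. *)
Lemma rootsR_all_simple f k b :
  all_simple_roots f k b -> rootsR f = mkseq b k.
Proof.
move=> [f0 szf inc rb]; have srt := sorted_mkseq inc.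
have uniqb : uniq (mkseq b k) by apply: lt_sorted_uniq.
have allb : all (root f) (mkseq b k).
  by apply/allP => _ /mapP[i + ->]; rewrite mem_iota => /rb.
apply: lt_sorted_eq; rewrite /rootsR ?sorted_roots // -/(rootsR f) => x.
have := roots_on_rootsR f0 x; rewrite in_itv /= => <-.
apply/idP/idP => [rx|/(allP allb)//]; apply: contraT => xb.
have := max_poly_roots f0 (rs := x :: mkseq b k); rewrite /= rx allb xb uniqb.
by move=> /(_ isT isT); rewrite size_mkseq ltnNge szf.
Qed.

Lemma nth_largest_root_all_simple f k b i :
  all_simple_roots f k b -> (i < k)%N ->
  nth_largest_root f (k - i) = b i.
Proof.
move=> sf ltik; rewrite /nth_largest_root (rootsR_all_simple sf).
rewrite nth_rev ?size_mkseq; last by lia.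
by rewrite nth_mkseq; [congr b; lia | lia].
Qed.

Lemma all_simple_roots_unique f k b b' i :
  all_simple_roots f k b -> all_simple_roots f k b' -> (i < k)%N ->
  b i = b' i.
Proof.
move=> sf sf' ltik; rewrite -(nth_largest_root_all_simple sf ltik).
exact: nth_largest_root_all_simple.
Qed.

(** The reflected sequence 1 - b (k - 1 - j) again lists all roots in increasing order, and such a
    list is unique. *)
Lemma all_simple_roots_sym f k b i :
  (forall x, root f x -> root f (1 - x)) ->
  all_simple_roots f k b -> (i < k)%N -> b i + b (k.-1 - i)%N = 1.
Proof.
move=> symf sf ltik; have [f0 szf inc rb] := sf.
have sf' : all_simple_roots f k (fun j => 1 - b (k.-1 - j)%N).
  split=> // [j ltj|j ltj]; last by apply/symf/rb; lia.
  have /inc : ((k.-1 - j.+1).+1 < k)%N by lia.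
  have -> : (k.-1 - j.+1).+1 = (k.-1 - j)%N by lia.
  lra.
by rewrite (all_simple_roots_unique sf sf' ltik); lra.
Qed.

Lemma ivt_alternating f a k :
  increasing_upto k.+1 a ->
  (forall i, (i <= k)%N -> 0 < (-1) ^+ i * f.[a i]) ->
  exists b, forall i, (i < k)%N -> [/\ a i < b i, b i < a i.+1 & root f (b i)].
Proof.
move=> inc alt.
(* The default 0 makes the claim total in [i], so that the witnesses form a function. *)
have H i : {x | (i < k)%N -> [/\ a i < x, x < a i.+1 & root f x]}.
  have [ltik|] := ltnP i k; last by exists 0.
  have lta : a i < a i.+1 by apply: inc.
  have sg : f.[a i] * f.[a i.+1] < 0.
    have := mulr_gt0 (alt _ (ltnW ltik)) (alt _ ltik).
    rewrite exprS mulN1r mulNr mulrN oppr_gt0 mulrACA -expr2 sqrr_sign mul1r.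
    by [].
  have [x] := poly_ivtoo (ltW lta) sg.
  by rewrite in_itv /= => /andP[h1 h2] rx; exists x.
by exists (fun i => sval (H i)) => i; apply: (svalP (H i)).
Qed.

Lemma horner_all_simple_roots f k b x :
  all_simple_roots f k b ->
  f.[x] = lead_coef f * \prod_(i < k) (x - b i).
Proof.
move=> [f0 szf inc rb]; have srt := sorted_mkseq inc.
have uniqb : uniq (mkseq b k) by apply: lt_sorted_uniq.
have allb : all (root f) (mkseq b k).
  by apply/allP => _ /mapP[i + ->]; rewrite mem_iota => /rb.
have szE : size f = (size (mkseq b k)).+1.
  apply/eqP; rewrite eqn_leq max_poly_roots // andbT.
  by rewrite size_mkseq.
have urs : poly.uniq_roots (mkseq b k) by rewrite uniq_rootsE.
rewrite {1}(all_roots_prod_XsubC szE allb urs) hornerZ horner_prod.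
congr (_ * _); rewrite big_map -{1}(subn0 k) -/(index_iota 0 k) big_mkord.
by apply: eq_bigr => i _; rewrite hornerXsubC.
Qed.

(** Exactly the k - i factors with j >= i are negative. *)
Lemma prod_gap_sign k b i x :
  in_gap k b i x -> (i <= k)%N ->
  0 < (-1) ^+ (k - i) * \prod_(j < k) (x - b j).
Proof.
elim: k i => [|k IH] i gap le_ik.
  by move: le_ik; rewrite leqn0 => /eqP->; rewrite big_ord0 mulr1 expr0.
have [lo hi] := gap; rewrite big_ord_recr /=.
move: le_ik; rewrite leq_eqVlt => /orP[/eqP eik|].
  have : 0 < (-1) ^+ (k - k) * \prod_(j < k) (x - b j).
    apply: IH => //; split=> j; first by move=> ?; apply: lo; lia.
    by move=> ? ?; lia.
  rewrite eik !subnn !expr0 !mul1r => h; apply: mulr_gt0 => //.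
  by rewrite subr_gt0; apply: lo; lia.
rewrite ltnS => le_ik; rewrite subSn // exprS.
have : 0 < (-1) ^+ (k - i) * \prod_(j < k) (x - b j).
  by apply: IH => //; split=> // j ? ?; apply: hi => //; lia.
have : x - b k < 0 by rewrite subr_lt0; apply: hi; lia.
nra.
Qed.

(** The sign of [f] flips from each gap to the next, so its sign at one point outside the roots
    fixes it in every gap. *)
Lemma gap_sign f k b i j x y :
  all_simple_roots f k b ->
  in_gap k b i x -> in_gap k b j y -> (i <= k)%N -> (j <= k)%N ->
  0 < (-1) ^+ i * f.[x] -> 0 < (-1) ^+ j * f.[y].
Proof.
move=> sf gx gy lei lej.
rewrite !(horner_all_simple_roots _ sf).
have := prod_gap_sign gx lei; have := prod_gap_sign gy lej.
(* Only the parities of the exponents matter, which leaves eight cases. *)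
rewrite -(signr_odd _ i) -(signr_odd _ j) -(signr_odd _ (k - i)).
rewrite -(signr_odd _ (k - j)) !oddB //.
move: (\prod_(_ < _) _) (\prod_(_ < _) _) (lead_coef f) => p q c.
by case: (odd i) (odd j) (odd k) => [] [] [] /=; rewrite ?expr0 ?expr1; nra.
Qed.

(** Each sign change gives a root, and the degree bound leaves room for no other. *)
Lemma ivt_all_simple_roots f a k :
  (size f <= k.+1)%N -> increasing_upto k.+1 a ->
  (forall i, (i <= k)%N -> 0 < (-1) ^+ i * f.[a i]) ->
  exists2 b, all_simple_roots f k b
    & forall i, (i < k)%N -> a i < b i /\ b i < a i.+1.
Proof.
move=> szf inc alt; have [b bP] := ivt_alternating inc alt.
exists b; last by move=> i /bP[].
split=> //; last by move=> i /bP[].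
  apply/eqP => f0; have := alt 0%N (leq0n _).
  by rewrite f0 horner0 mulr0 ltxx.
move=> i lti; have [_ h _] := bP i (ltnW lti); have [h' _ _] := bP _ lti.
exact: lt_trans h h'.
Qed.

Lemma in_gap_consecutive k b i x :
  increasing_upto k b -> (i <= k)%N ->
  ((0 < i)%N -> b i.-1 < x) -> ((i < k)%N -> x < b i) -> in_gap k b i x.
Proof.
move=> inc leik lo hi; split=> j h.
  apply: le_lt_trans (lo _); last by lia.
  by apply: (increasing_upto_le inc); lia.
move=> ltj; apply: lt_le_trans (hi _) _; first by lia.
exact: (increasing_upto_le inc).
Qed.

End RealRoots.

(** * Shifted Legendre polynomials and the two f-polynomials *)

Ltac field_pos := field; do ?[apply/andP; split]; apply: lt0r_neq0; lra.

Section Legendre.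
Context {R : realType}.
Implicit Types (m n i j : nat).

Local Notation B n m := ('C(n, m)%:R : R).

(** Stated in [R], where n - m does not truncate; for m > n both binomials vanish. *)
Lemma natr_bin_left n m : m.+1%:R * B n m.+1 = (n%:R - m%:R) * B n m.
Proof.
rewrite -natrM mul_bin_left natrM.
have [le_mn|lt_nm] := leqP m n; first by rewrite natrB.
by rewrite bin_small // !mulr0.
Qed.

Lemma natr_bin_diag n m : n.+1%:R * B n m = m.+1%:R * B n.+1 m.+1.
Proof. by rewrite -!natrM -mul_bin_diag. Qed.

Lemma natr_bin_down n m : n.+1%:R * B n m = (n.+1%:R - m%:R) * B n.+1 m.
Proof. by rewrite -natr_bin_left natr_bin_diag. Qed.

Definition legendre_coef n j : R := B n j * B (n + j) j.

(* P_n(1 - 2t), with P_n the n-th Legendre polynomial. *)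
Definition legendre n : {poly R} :=
  \poly_(j < n.+1) ((-1) ^+ j * legendre_coef n j).

Lemma coef_legendre n j : (legendre n)`_j = (-1) ^+ j * legendre_coef n j.
Proof.
rewrite coef_poly ltnS; case: leqP => // lt_nj.
by rewrite /legendre_coef bin_small // mul0r mulr0.
Qed.

Lemma legendre_coef0 n : legendre_coef n 0 = 1.
Proof. by rewrite /legendre_coef !bin0 mulr1. Qed.

Lemma natrS_neq0 n : (n.+1%:R : R) != 0.
Proof. by rewrite pnatr_eq0. Qed.

Lemma natr1_neq0 n : (n%:R + 1 : R) != 0.
Proof. by rewrite natr1 pnatr_eq0. Qed.

(** This ratio and the next two turn neighbouring coefficients into rational multiples of a single
    one, so that comparing coefficients becomes a task for [field]. *)
Lemma legendre_coefS n i :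
  legendre_coef n i.+1
  = (n%:R - i%:R) * (n%:R + i%:R + 1) / (i%:R + 1) ^+ 2 * legendre_coef n i.
Proof.
have h1 := natr_bin_left n i; have h2 := natr_bin_diag (n + i) i.
rewrite /legendre_coef addnS; have h0 := natrS_neq0 i.
rewrite -!natr1 in h1 h2 h0; rewrite natrD in h2.
(* One factor i + 1 is supplied for each of the two binomials. *)
apply: (mulfI h0); apply: (mulfI h0).
transitivity (((i%:R + 1) * B n i.+1) * ((i%:R + 1) * B (n + i).+1 i.+1)).
  by ring.
by rewrite h1 -h2; field.
Qed.

Lemma legendre_coefSS n i :
  legendre_coef n.+1 i.+1
  = (n%:R + i%:R + 1) * (n%:R + i%:R + 2) / (i%:R + 1) ^+ 2
    * legendre_coef n i.
Proof.
have h1 := natr_bin_diag n i; have h2 := natr_bin_diag (n + i).+1 i.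
have h3 := natr_bin_down (n + i) i.
rewrite /legendre_coef addnS addSn; have h0 := natrS_neq0 i.
have hn := natrS_neq0 n.
rewrite -!natr1 natrD in h1 h2 h3 h0 hn.
apply: (mulfI h0); apply: (mulfI h0).
transitivity (((i%:R + 1) * B n.+1 i.+1) * ((i%:R + 1) * B (n + i).+2 i.+1)).
  by ring.
rewrite -h1 -h2.
transitivity (B n i * (n%:R + i%:R + 1 + 1)
              * ((n%:R + i%:R + 1 - i%:R) * B (n + i).+1 i)).
  by ring.
by rewrite -h3; field.
Qed.

Lemma legendre_coef_predS n i :
  legendre_coef n i.+1
  = (n%:R + 1 - i%:R) * (n%:R - i%:R) / (i%:R + 1) ^+ 2
    * legendre_coef n.+1 i.
Proof.
have h1 := natr_bin_left n i; have h2 := natr_bin_left (n + i).+1 i.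
have h3 := natr_bin_down n i.
rewrite /legendre_coef addnS addSn; have h0 := natrS_neq0 i.
rewrite -!natr1 natrD in h1 h2 h3 h0.
apply: (mulfI h0); apply: (mulfI h0).
transitivity (((i%:R + 1) * B n i.+1) * ((i%:R + 1) * B (n + i).+1 i.+1)).
  by ring.
rewrite h1 h2.
transitivity ((n%:R - i%:R) * ((n%:R + 1) * B n i) * B (n + i).+1 i).
  by ring.
by rewrite h3; field.
Qed.

(** Bonnet's recurrence in the variable 1 - 2t; every coefficient of degree i + 1 reduces to
    [legendre_coef n.+1 i]. *)
Lemma legendre_rec n :
  n.+2%:R *: legendre n.+2
  = (2 * n + 3)%:R *: ((1 - 2%:R *: 'X) * legendre n.+1)
    - n.+1%:R *: legendre n.
Proof.
apply/polyP => j; rewrite mulrBl mul1r -scalerAl.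
rewrite !(coefB, coefZ, coefXM) !coef_legendre.
case: j => [|i] /=; first by rewrite !legendre_coef0 !expr0; ring.
rewrite (legendre_coefSS n.+1) (legendre_coefS n.+1) legendre_coef_predS.
have h0 := natr1_neq0 i.
rewrite exprS; move: ((-1) ^+ i) => s.
by field.
Qed.


(* The primitive of - legendre n.+1 vanishing at 0 and at 1. *)
Definition legendre_prim n : {poly R} :=
  (4 * n + 6)%:R^-1 *: (legendre n.+2 - legendre n).

Lemma coef_legendre_prim0 n : (legendre_prim n)`_0 = 0.
Proof. by rewrite coefZ coefB !coef_legendre !legendre_coef0 subrr mulr0. Qed.

(** Termwise integration of [- legendre n.+1]: its coefficient of degree i is divided by i + 1. *)
Lemma coef_legendre_primS n i :
  (legendre_prim n)`_i.+1
  = (-1) ^+ i.+1 * legendre_coef n.+1 i / (i%:R + 1).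
Proof.
rewrite coefZ coefB !coef_legendre (legendre_coefSS n.+1) legendre_coef_predS.
have h0 := natr1_neq0 i; have h1 : ((4 * n + 6)%:R : R) != 0.
  by rewrite pnatr_eq0 addnS.
move: ((-1) ^+ i.+1) (legendre_coef _ _) h1 => s c.
rewrite natrD natrM => h1.
by field; rewrite h0 h1.
Qed.

(** * The polynomial f_D in terms of Legendre polynomials *)

Lemma natr_fD_coefS n i :
  (fD_coef n.+2 i.+1)%:R
  = ((n%:R + 2) * (n%:R + i%:R + 2) / (i%:R + 1) ^+ 2 + i%:R / (i%:R + 1))
    * legendre_coef n.+1 i.
Proof.
rewrite /fD_coef.
have -> : (n.+2 + i.+1 - 1 = (n.+1 + i).+1)%N by lia.
have -> : (n.+2 + i.+1 - 2 = n.+1 + i)%N by lia.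
have -> : (n.+2 - 2 = n)%N by lia.
(* The guarded binomial agrees with this formula at i = 0 too, where both sides are 0. *)
have e : n.+1%:R * ((if (1 < i.+1)%N then 'C(n, i.+1 - 2) else 0)%:R)
    = i%:R * B n.+1 i.
  case: i => [|i]; first by rewrite mulr0 mul0r.
  by rewrite ltnS /= subSS subn1 /= natr_bin_diag.
move: (if _ then _ else _) e => u e.
have h1 := natr_bin_diag n.+1 i; have h2 := natr_bin_diag (n.+1 + i) i.
have h3 := natr_bin_left (n.+1 + i) i; have h0 := natr1_neq0 i.
have hn := natr1_neq0 n.
rewrite natrD !natrM /legendre_coef.
move: (B n.+2 _) (B n.+1 i) (B (n.+1 + i).+1 _) (B (n.+1 + i) _)
  (B (n.+1 + i) _) (u%:R) h1 h2 h3 e => a b c d d' v.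
move=> h1 h2 h3 h4; rewrite -!natr1 ?natrD -?natr1 in h1 h2 h3 h4.
have -> : a = (n%:R + 1 + 1) * b / (i%:R + 1) by rewrite h1; field.
have -> : c = (n%:R + i%:R + 1 + 1) * d' / (i%:R + 1) by rewrite h2; field.
have -> : d = (n%:R + i%:R + 1 - i%:R) * d' / (i%:R + 1) by rewrite -h3; field.
have -> : v = i%:R * b / (n%:R + 1) by rewrite -h4; field.
by field; rewrite h0 hn.
Qed.

Lemma coef_fD n j : (fD R n.+2)`_j = (-1) ^+ j * (fD_coef n.+2 j)%:R.
Proof.
have -> : fD R n.+2 = \poly_(i < n.+3) ((-1) ^+ i * (fD_coef n.+2 i)%:R).
  by rewrite poly_def.
rewrite coef_poly; case: ltnP => // lt_nj.
rewrite /fD_coef bin_small // mul0n add0n.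
case: ifP => _; rewrite ?mul0n ?mulr0 //.
by rewrite bin_small ?mul0n ?mulr0 //; lia.
Qed.

(** Here l = n + 2, so the factor l - 2 is [n]. *)
Lemma fD_legendre n :
  fD R n.+2 = (1 - 2%:R *: 'X) * legendre n.+1 + n%:R *: legendre_prim n.
Proof.
have := coef_legendre_primS n; have := coef_legendre_prim0 n.
move: (legendre_prim n) => w w0 wS.
apply/polyP => j; rewrite mulrBl mul1r -scalerAl !(coefD, coefN, coefZ, coefXM).
rewrite coef_fD !coef_legendre.
case: j => [|i] /=.
  rewrite w0 legendre_coef0 /fD_coef !bin0 /= !expr0.
  by rewrite mul0n; ring.
rewrite wS natr_fD_coefS (legendre_coefS n.+1).
have h0 := natr1_neq0 i; rewrite exprS.
move: ((-1) ^+ i) (legendre_coef _ _) => s c.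
by rewrite -natr1; field.
Qed.

(** * The polynomial f_D^+ from its Rodrigues formula *)

Lemma coef_expr1BX k j : ((1 - 'X : {poly R}) ^+ k)`_j = (-1) ^+ j * B k j.
Proof.
elim: k j => [|k IH] j.
  rewrite expr0 coef1 bin0n; case: j => [|j]; first by rewrite expr0 mulr1.
  by rewrite mulr0.
rewrite exprS mulrBl mul1r coefB coefXM !IH; case: j => [|j] /=.
  by rewrite !bin0 subr0.
by rewrite binS natrD exprS; ring.
Qed.

(** For l = n + 3 the left side is what the n-fold derivative and the factor 1/(l - 2)! contribute;
    the right side brings in the second binomial of [legendre_coef n.+2 i]. *)
Lemma natr_ffact_fact n i :
  ((n + i.+1) ^_ n)%:R / (n.+1)`!%:R
  = (n%:R + 2) / ((i%:R + 1) * (n%:R + i%:R + 2)) * B (n.+2 + i) i.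
Proof.
have -> : ((n + i.+1) ^_ n)%:R / (n.+1)`!%:R = B (n + i.+1) i.+1 / n.+1%:R.
  have -> : B (n + i.+1) i.+1 = B (n + i.+1) n.
    by rewrite -[in RHS]bin_sub ?leq_addr // addnC addnK.
  rewrite -bin_ffact factS !natrM.
  have hn := natrS_neq0 n; have hf : (n`!%:R : R) != 0.
    by rewrite pnatr_eq0 -lt0n fact_gt0.
  by field; rewrite nat1r hn hf.
have h1 := natr_bin_left (n.+1 + i) i; have h2 := natr_bin_down (n.+1 + i) i.
rewrite [(n + i.+1)%N]addnS -addSn.
have h0 := natr1_neq0 i; have hn := natrS_neq0 n.
have hni := natrS_neq0 (n.+1 + i).
rewrite -[(n.+2 + i)%N]/((n.+1 + i).+1); move: (B _ i.+1) (B _ i) (B _ i) h1 h2.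
move=> a b c; rewrite -addn1 natrD.
rewrite -(natr1 (n.+1 + i)%N) natrD -(natr1 n) in hn hni *.
move=> h1 h2; have n_ge0 := ler0n R n; have i_ge0 := ler0n R i.
have -> : a = (n%:R + 1) * c / (i%:R + 1).
  by apply: (mulfI h0); rewrite h1; field.
have -> : c = (n%:R + 2) * b / (n%:R + i%:R + 2).
  by apply: (mulfI hni); rewrite h2; field_pos.
by field_pos.
Qed.

(** Deriving n times moves degree n + j to degree j, which undoes the factor X^n. The guards stand
    for binomials with negative lower index. *)
Lemma coef_fD_pos n j :
  (fD_pos R n.+3)`_j
  = ((n + j) ^_ n)%:R / (n.+1)`!%:R * (-1) ^+ j
    * (n.+1%:R * B n.+1 j
       + (3 * n + 5)%:R * ((if (j == 0)%N then 0 else B n.+1 j.-1)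
                           + (if (j < 2)%N then 0 else B n.+1 (j - 2)))).
Proof.
rewrite /fD_pos.
have -> : (n.+3 - 2 = n.+1)%N by lia.
have -> : (n.+3 - 3 = n)%N by lia.
have -> : (3 * n.+3 - 4 = 3 * n + 5)%N by lia.
rewrite coefZ coef_derivn -mulrA coefXnM ltnNge leq_addr /= addKn.
rewrite mulrDr mulrBr -!scalerAr !(coefD, coefN, coefZ) coefMC coefMX coefMXn.
rewrite -mulr_natr !coef_expr1BX.
case: j => [|[|j]] /=; rewrite ?subn1 ?subn2 ?exprS ?expr0 /=; ring.
Qed.

Lemma coef_fD_posS n i :
  (fD_pos R n.+3)`_i.+1
  = (-1) ^+ i.+1 * legendre_coef n.+2 i
    * ((n%:R + 1) * (n%:R + 2 - i%:R) * (n%:R + 1 - i%:R)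
       + (3 * n%:R + 5) * (n%:R + 2) * (i%:R + 1))
    / ((i%:R + 1) ^+ 2 * (n%:R + i%:R + 2)).
Proof.
rewrite coef_fD_pos natr_ffact_fact /=.
(* Pascal's rule merges the two terms with factor 3l - 4. *)
have -> : B n.+1 i + (if (i.+1 < 2)%N then 0 else B n.+1 (i.+1 - 2)) = B n.+2 i.
  by case: i => [|i]; rewrite ?bin0 ?addr0 // (binS n.+1) natrD !subSS subn0.
have h1 := natr_bin_left n.+1 i; have h2 := natr_bin_down n.+1 i.
have h0 := natr1_neq0 i; have hn := natrS_neq0 n.+1.
rewrite /legendre_coef.
move: (B n.+1 i.+1) (B n.+1 i) (B n.+2 i) (B (n.+2 + i) i) h1 h2.
move=> a b c d; rewrite -(natr1 i).
rewrite -(natr1 n.+1) -(natr1 n) in hn *.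
rewrite natrD natrM => h1 h2.
have n_ge0 := ler0n R n; have i_ge0 := ler0n R i.
have -> : a = (n%:R + 1 - i%:R) * b / (i%:R + 1).
  by apply: (mulfI h0); rewrite h1; field.
have -> : b = (n%:R + 2 - i%:R) * c / (n%:R + 2).
  by apply: (mulfI hn); rewrite h2; field_pos.
by move: ((-1) ^+ i.+1) => s; field_pos.
Qed.

Lemma fD_pos_legendre n :
  fD_pos R n.+3 = (1 - 'X) ^+ 2 * legendre n.+2
    + (n.+3%:R *: 'X - 2%:R%:P) * legendre_prim n.+1.
Proof.
have := coef_legendre_primS n.+1; have := coef_legendre_prim0 n.+1.
have := coef_fD_posS n; have := coef_fD_pos n 0.
move: (legendre_prim n.+1) (fD_pos R n.+3) => w F F0 FS w0 wS.
have -> : (1 - 'X) ^+ 2 * legendre n.+2 = legendre n.+2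
    - 2%:R *: ('X * legendre n.+2) + 'X * ('X * legendre n.+2).
  by rewrite scaler_nat; ring.
apply/polyP => j; rewrite mulrBl -scalerAl mul_polyC.
rewrite !(coefD, coefN, coefZ, coefXM).
case: j => [|i] /=.
  rewrite w0 coef_legendre legendre_coef0 F0 addn0 ffactnn bin0 !expr0 /=.
  rewrite factS natrM; have hf : (n`!%:R : R) != 0.
    by rewrite pnatr_eq0 -lt0n fact_gt0.
  by field; rewrite nat1r natrS_neq0 hf.
rewrite wS FS !coef_legendre (legendre_coefS n.+2).
have n_ge0 := ler0n R n.
(* Degree 1 is treated apart: the terms two degrees below follow the general formula only from
   degree 2 on. *)
case: i => [|i] /=.
  by rewrite w0 legendre_coef0 expr0 expr1; field_pos.
rewrite wS (legendre_coefS n.+2 i).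
have i_ge0 := ler0n R i; rewrite !exprS.
move: ((-1) ^+ i) (legendre_coef _ _) => s c.
by field_pos.
Qed.

(** * Values, recurrence and symmetry under t -> 1 - t *)

Lemma size_legendre n : (size (legendre n) <= n.+1)%N.
Proof. exact: size_poly. Qed.

Lemma legendre_at0 n : (legendre n).[0] = 1.
Proof. by rewrite horner_coef0 coef_legendre legendre_coef0 expr0 mulr1. Qed.

Lemma horner_legendre0 x : (legendre 0).[x] = 1.
Proof.
by rewrite (size1_polyC (size_legendre 0)) hornerC coef_legendre legendre_coef0
  expr0 mulr1.
Qed.

Lemma horner_legendre1 x : (legendre 1).[x] = 1 - 2 * x.
Proof.
rewrite /legendre horner_poly !big_ord_recl big_ord0 /= /bump /=.
by rewrite legendre_coef0 /legendre_coef (_ : 'C(1 + 1, 1) = 2%N) // binn; ring.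
Qed.

Lemma horner_legendreSS n x :
  (n%:R + 2) * (legendre n.+2).[x]
  = (2 * n%:R + 3) * (1 - 2 * x) * (legendre n.+1).[x]
    - (n%:R + 1) * (legendre n).[x].
Proof.
have h := congr1 (horner^~ x) (legendre_rec n).
rewrite /= !(hornerZ, hornerM, hornerD, hornerN, hornerC, hornerX) in h.
have -> : n%:R + 2 = n.+2%:R :> R by rewrite -!natr1; ring.
by rewrite h natrD natrM -(natr1 n); ring.
Qed.

(** The middle term of the recurrence drops out. The negative factor left over is the source of all
    interlacing below. *)
Lemma horner_legendreSS_root n x : root (legendre n.+1) x ->
  (legendre n.+2).[x] = - ((n%:R + 1) / (n%:R + 2)) * (legendre n).[x].
Proof.
move=> /eqP rx; have := horner_legendreSS n x; rewrite rx mulr0 sub0r => e.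
have hn : n%:R + 2 != 0 :> R by rewrite -natrD addn2 pnatr_eq0.
by apply: (mulfI hn); rewrite e; field.
Qed.

Lemma legendre_sym n x : (legendre n).[1 - x] = (-1) ^+ n * (legendre n).[x].
Proof.
(* The recurrence reaches back two degrees, so the induction carries two consecutive ones. *)
suff H : (legendre n).[1 - x] = (-1) ^+ n * (legendre n).[x]
    /\ (legendre n.+1).[1 - x] = (-1) ^+ n.+1 * (legendre n.+1).[x].
  by case: H.
elim: n => [|n [IH0 IH1]].
  by rewrite !horner_legendre0 !horner_legendre1 expr0 expr1; split; ring.
split=> //; have n_ge0 := ler0n R n.
have hn : n%:R + 2 != 0 :> R by apply: lt0r_neq0; lra.
apply: (mulfI hn); rewrite mulrCA !horner_legendreSS IH0 IH1 !exprS; ring.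
Qed.

Lemma legendre_at1 n : (legendre n).[1] = (-1) ^+ n.
Proof. by rewrite -[1 in LHS]subr0 legendre_sym legendre_at0 mulr1. Qed.

Lemma horner_legendre_prim n x :
  (legendre_prim n).[x]
  = (4 * n%:R + 6)^-1 * ((legendre n.+2).[x] - (legendre n).[x]).
Proof. by rewrite /legendre_prim hornerZ hornerD hornerN natrD natrM. Qed.

Lemma legendre_prim_sym n x :
  (legendre_prim n).[1 - x] = (-1) ^+ n * (legendre_prim n).[x].
Proof. by rewrite !horner_legendre_prim !legendre_sym !exprS; ring. Qed.

Lemma size_legendre_prim n : (size (legendre_prim n) <= n.+3)%N.
Proof.
apply: leq_trans (size_scale_leq _ _) _.
apply: leq_trans (size_polyD _ _) _; rewrite size_polyN geq_max size_legendre.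
by apply: leq_trans (size_legendre _) _; lia.
Qed.

(** * Interlacing of roots *)

(** Induction on [n]: at 0, at the roots of P_{n+1} and at 1, P_{n+2} alternates in sign, which
    yields all its roots. The last conjunct is the alternation handed to the next step. *)
Lemma legendre_roots n :
  exists r : nat -> R,
  [/\ all_simple_roots (legendre n.+1) n.+1 r, 0 < r 0%N, r n < 1
    & forall i, (i <= n)%N -> 0 < (-1) ^+ i * (legendre n).[r i]].
Proof.
elim: n => [|n [r [rS r0 rn rP]]].
  exists (fun=> 1 / 2); split; try lra.
    split=> // [||i _].
    - apply/eqP => l0; have := legendre_at0 1; rewrite l0 horner0; lra.
    - exact: size_legendre.
    - by rewrite /root horner_legendre1; apply/eqP; lra.
  by case=> // _; rewrite horner_legendre0 expr0; lra.
have [_ _ inc rr] := rS; have n_ge0 := ler0n R n.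
pose a i := if i is i'.+1 then if (i' <= n)%N then r i' else 1 else 0.
have inca : increasing_upto n.+3 a.
  case=> [|i] lti; rewrite /a //=.
  have [lt_in|le_ni] := ltnP i n.
    by rewrite (ltnW lt_in); apply: inc.
  by rewrite (_ : i = n) ?leqnn //; lia.
have alt i : (i <= n.+2)%N -> 0 < (-1) ^+ i * (legendre n.+2).[a i].
  case: i => [|i] lei; first by rewrite /a legendre_at0 expr0 mulr1 ltr01.
  rewrite /a; case: leqP => [le_in|lt_ni].
    rewrite (horner_legendreSS_root (rr i le_in)) exprS.
    rewrite (_ : -1 * _ * _ = (n%:R + 1) / (n%:R + 2)
      * ((-1) ^+ i * (legendre n).[r i])); last by ring.
    by apply: mulr_gt0; [apply: divr_gt0; lra | apply: rP].
  rewrite (_ : i = n.+1); last by lia.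
  by rewrite legendre_at1 -expr2 sqrr_sign ltr01.
have [s sS sP] := ivt_all_simple_roots (size_legendre n.+2) inca alt.
exists s; split=> //.
- by have [] := sP 0%N isT.
- by have [_] := sP n.+1 (leqnn _); rewrite /a ltnn.
(* The new root [s i] lies in gap i of the old roots, and the value at 0 is 1. *)
move=> i lei; apply: (gap_sign (i := 0) (x := 0) rS) => //.
- by apply: in_gap_consecutive.
- have [h1 h2] := sP i lei; apply: in_gap_consecutive => //.
    by case: i lei h1 {h2} => // i lei; rewrite /a (_ : (i <= n)%N).
  by move=> le_in; move: h2; rewrite /a (_ : (i <= n)%N).
- by rewrite legendre_at0 expr0 mulr1 ltr01.
Qed.

(** At a root of P_{n+1} the values of P_{n+2} and P_n have opposite signs, so their difference has
    the sign of -P_n and alternates. This gives [n] inner roots, to which 0 and 1 are added. *)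
Lemma legendre_interlacing n :
  exists r w : nat -> R,
  [/\ all_simple_roots (legendre n.+1) n.+1 r,
      all_simple_roots (legendre_prim n) n.+2 w,
      w 0%N = 0 /\ w n.+1 = 1,
      forall i, (i <= n)%N -> w i < r i /\ r i < w i.+1
    & (forall i, (i <= n)%N -> 0 < (-1) ^+ i.+1 * (legendre_prim n).[r i])
      /\ (forall i, (i <= n.+1)%N -> 0 < (-1) ^+ i * (legendre n.+1).[w i])].
Proof.
have [r [rS r0 rn rP]] := legendre_roots n; have n_ge0 := ler0n R n.
have [_ _ inc rr] := rS.
have rW i : (i <= n)%N -> 0 < (-1) ^+ i.+1 * (legendre_prim n).[r i].
  move=> le_in; have h := rP i le_in; rewrite horner_legendre_prim mulrCA.
  apply: mulr_gt0; first by rewrite invr_gt0; lra.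
  rewrite (horner_legendreSS_root (rr i le_in)) exprS.
  rewrite (_ : -1 * _ * _ = ((n%:R + 1) / (n%:R + 2) + 1)
    * ((-1) ^+ i * (legendre n).[r i])); last by ring.
  by apply: mulr_gt0 => //; apply: ltr_wpDl => //; apply: divr_ge0; lra.
(* The sign is reversed because [ivt_alternating] expects a positive first value. *)
have [v vP] : exists v, forall i, (i < n)%N ->
    [/\ r i < v i, v i < r i.+1 & root (- legendre_prim n) (v i)].
  apply: ivt_alternating => // i le_in; have := rW i le_in.
  by rewrite exprS hornerN; lra.
pose w i := if i is i'.+1 then if (i' < n)%N then v i' else 1 else 0.
have wr i : (i <= n)%N -> w i < r i /\ r i < w i.+1.
  move=> le_in; split.
    case: i le_in => // i lt_in; rewrite /w lt_in.
    by have [] := vP i lt_in.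
  rewrite /w; case: ltnP => [lt_in|le_ni]; first by have [] := vP i lt_in.
  by rewrite (_ : i = n) //; lia.
have w1 : w n.+1 = 1 by rewrite /w ltnn.
have wz : (legendre_prim n).[0] = 0.
  by rewrite horner_coef0 coef_legendre_prim0.
have incw : increasing_upto n.+2 w.
  by move=> i lti; have [h1 h2] := wr i lti; apply: lt_trans h1 h2.
have wS : all_simple_roots (legendre_prim n) n.+2 w.
  split=> //.
  - apply/eqP => p0; have := rW 0%N (leq0n _).
    by rewrite p0 horner0 mulr0 ltxx.
  - exact: size_legendre_prim.
  case=> [|i] lti; first by rewrite /root wz.
  rewrite /w; case: ltnP => [lt_in|_].
    by have [_ _] := vP i lt_in; rewrite rootN.
  by rewrite /root -[1]subr0 legendre_prim_sym wz mulr0.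
exists r, w; split=> //; split=> // i le_in.
apply: (gap_sign (i := 0) (x := 0) rS) => //.
- by apply: in_gap_consecutive.
- apply: in_gap_consecutive => // [|lt_in]; last by have [] := wr i lt_in.
  by case: i le_in => // i le_in _; have [] := wr i le_in.
- by rewrite legendre_at0 expr0 mulr1 ltr01.
Qed.

(** * Locating and comparing the roots of f_D and f_D^+ *)

Lemma horner_fD n x :
  (fD R n.+2).[x]
  = (1 - 2 * x) * (legendre n.+1).[x] + n%:R * (legendre_prim n).[x].
Proof.
by rewrite fD_legendre !(hornerZ, hornerM, hornerD, hornerN, hornerC, hornerX).
Qed.

Lemma horner_fD_pos n x :
  (fD_pos R n.+3).[x]
  = (1 - x) ^+ 2 * (legendre n.+2).[x]
    + ((n%:R + 3) * x - 2) * (legendre_prim n.+1).[x].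
Proof.
rewrite fD_pos_legendre.
rewrite !(horner_exp, hornerZ, hornerM, hornerD, hornerN, hornerC, hornerX).
by rewrite -(natrD _ n 3) addn3.
Qed.

Lemma size_fD n : (size (fD R n) <= n.+1)%N.
Proof.
rewrite /fD -(poly_def n.+1 (fun j => (-1) ^+ j * (fD_coef n j)%:R)).
exact: size_poly.
Qed.

Lemma size_fD_pos n : (size (fD_pos R n.+3) <= n.+4)%N.
Proof.
apply/leq_sizeP => -[|[|j]] // lt_nj; rewrite coef_fD_pos /= subn2 /=.
have -> : 'C(n.+1, j.+2) = 0%N by rewrite bin_small //; lia.
have -> : 'C(n.+1, j.+1) = 0%N by rewrite bin_small //; lia.
have -> : 'C(n.+1, j) = 0%N by rewrite bin_small //; lia.
by rewrite addr0 !mulr0 addr0 mulr0.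
Qed.

Lemma fD_sym n x : (fD R n.+2).[1 - x] = (-1) ^+ n * (fD R n.+2).[x].
Proof. by rewrite !horner_fD legendre_sym legendre_prim_sym exprS; ring. Qed.

Lemma root_sym (f : {poly R}) n :
  (forall x, f.[1 - x] = (-1) ^+ n * f.[x]) ->
  forall x, root f x -> root f (1 - x).
Proof. by move=> symf x /eqP fx; rewrite /root symf fx mulr0. Qed.

(** Here l = n + 4 and roots are indexed upwards from 0. The bound n + 3 <= 2j says that w_j >= 1/2;
    the gap ]w_j, w_{j+1}[ then contains both e_j and b_{j+1}. *)
Lemma fD_roots_interlace n :
  exists b e : nat -> R,
  [/\ all_simple_roots (fD R n.+4) n.+4 b,
      all_simple_roots (fD_pos R n.+4) n.+4 e
    & forall j, (n.+3 <= j.*2)%N -> (j <= n.+2)%N -> b j < e j /\ e j < b j.+1].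
Proof.
have [r [w [rS wS [w0 w1] wr [rW wP]]]] := legendre_interlacing n.+2.
have [_ _ incr rr] := rS; have [_ _ incw rw] := wS.
have n_ge0 := ler0n R n.
have symw i : (i <= n.+3)%N -> w i + w (n.+3 - i)%N = 1.
  move=> lei.
  exact: (all_simple_roots_sym (root_sym (legendre_prim_sym _)) wS).
have symr : r 0%N + r n.+2 = 1.
  by apply: (all_simple_roots_sym (root_sym (legendre_sym _)) rS).
have w_lt i j : (i < j)%N -> (j <= n.+3)%N -> w i < w j.
  by move=> lt_ij lej; apply: (increasing_upto_lt incw).
have w_lo i : (i.*2 < n.+3)%N -> w i < 1 / 2.
  move=> lei; have := symw i; have := w_lt i (n.+3 - i)%N.
  by move=> /(_ ltac:(lia) ltac:(lia)) ? /(_ ltac:(lia)); lra.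
have w_hi i : (n.+3 < i.*2)%N -> (i <= n.+3)%N -> 1 / 2 < w i.
  move=> gti lei; have := symw i lei; have := w_lt (n.+3 - i)%N i.
  by move=> /(_ ltac:(lia) ltac:(lia)); lra.
have w_mid i : (i.*2 = n.+3)%N -> w i = 1 / 2.
  move=> ei; have := symw i; rewrite (_ : n.+3 - i = i)%N; last by lia.
  by move=> /(_ ltac:(lia)); lra.
(* The w_i below 1/2, then the middle r_i, then the w_i above 1/2: at 1/2 the
   factor 1 - 2t reverses the sign of f_D on the w_i, and the one or two middle
   r_i supply the missing alternations. *)
pose a j := if (j.*2 < n.+3)%N then w j
            else if (n.+3.+2 < j.*2)%N then w j.-1 else r j.-1.
have r_lt j : (j < n.+2)%N -> r j < r j.+1 by move=> ltj; apply: incr.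
have inca : increasing_upto n.+4.+1 a.
  move=> j ltj; rewrite /a.
  case: ifP => h1; case: ifP => h2; try lia.
  - by apply: incw; lia.
  - case: ifP => h3; try lia.
    by have [] := wr j; [lia | move=> *; rewrite /=; lra].
  - case: ifP => h3; [lia | case: ifP => h4; last by lia].
    by case: j ltj h1 h2 h3 h4 => //= j *; apply: incw; lia.
  - case: ifP => h3; first by lia.
    case: j ltj h1 h2 h3 => //= j *; case: ifP => h4; last by apply: r_lt; lia.
    by have [] := wr j; [lia | move=> *; lra].
have alta j : (j <= n.+4)%N -> 0 < (-1) ^+ j * (fD R n.+4).[a j].
  move=> lej; rewrite horner_fD /a.
  case: ifP => h1.
    have /eqP -> := rw j ltac:(lia); rewrite mulr0 addr0 mulrCA.
    by apply: mulr_gt0; [have := w_lo j h1; lra | apply: wP; lia].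
  case: j lej h1 => [|j] //= lej h1; case: ifP => h2.
    have /eqP -> := rw j ltac:(lia); rewrite mulr0 addr0 mulrCA exprS.
    have h := w_hi j ltac:(lia) ltac:(lia).
    rewrite mulN1r mulNr mulrN -mulNr.
    by apply: mulr_gt0; [lra | apply: wP; lia].
  have /eqP -> := rr j ltac:(lia); rewrite mulr0 add0r mulrCA.
  by apply: mulr_gt0; [rewrite ltr0n | apply: rW; lia].
have [b bS bP] := ivt_all_simple_roots (size_fD n.+4) inca alta.
(* Both terms of f_D^+ vanish at w_{n+3} = 1, so the largest root of P serves as last point
   instead. *)
pose c j := if (j <= n.+2)%N then w j else r n.+2.
have incc : increasing_upto n.+4 c.
  move=> j ltj; rewrite /c (_ : (j <= n.+2)%N) //; case: ifP => h.
    by apply: incw; lia.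
  by rewrite (_ : j = n.+2); [have [] := wr n.+2 | lia].
have fP j : (j <= n.+2)%N -> 0 < (-1) ^+ j * (fD_pos R n.+4).[w j].
  move=> lej; rewrite horner_fD_pos.
  have /eqP -> := rw j ltac:(lia); rewrite mulr0 addr0 mulrCA.
  apply: mulr_gt0; last by apply: wP; lia.
  by apply: exprn_gt0; rewrite subr_gt0 -w1; apply: w_lt.
have altc j : (j <= n.+3)%N -> 0 < (-1) ^+ j * (fD_pos R n.+4).[c j].
  rewrite /c; case: ifP => h lej; first exact: fP.
  rewrite (_ : j = n.+3); last by lia.
  rewrite horner_fD_pos; have /eqP -> := rr n.+2 (leqnn _).
  rewrite mulr0 add0r mulrCA; apply: mulr_gt0; last exact: rW.
  (* By symmetry the largest root of P exceeds 1/2, whence l t - 2 > 0 there, as l >= 4. *)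
  have := increasing_upto_lt incr (ltn0Sn n.+1) (leqnn _).
  by rewrite -(natr1 n); nra.
have [e0 eP] := ivt_alternating incc altc.
pose e j := if (j <= n.+2)%N then e0 j else 1.
have c_lt1 j : (j <= n.+3)%N -> c j < 1.
  rewrite /c; case: ifP => h lej; rewrite -w1; first exact: w_lt.
  by have [] := wr n.+2 (leqnn _).
have eS : all_simple_roots (fD_pos R n.+4) n.+4 e.
  split.
  - apply/eqP => f0; have := fP 0%N (leq0n _).
    by rewrite f0 horner0 mulr0 ltxx.
  - exact: size_fD_pos.
  - move=> j ltj; rewrite /e (_ : (j <= n.+2)%N) //; case: ifP => h.
      have [_ h1 _] := eP j ltj; have [h2 _ _] := eP j.+1 h.
      exact: lt_trans h1 h2.
    by have [_ h1 _] := eP j ltj; apply: lt_trans h1 (c_lt1 _ _).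
  move=> j ltj; rewrite /e; case: ifP => h; first by have [] := eP j h.
  rewrite /root horner_fD_pos subrr expr0n mul0r add0r.
  have /eqP := rw n.+3 (leqnn _); rewrite w1 => ->.
  by rewrite mulr0.
exists b, e; split=> // j lo hi.
have e_gt : w j < e j.
  by rewrite /e hi; have [+ _ _] := eP j hi; rewrite /c hi.
have w_ge : 1 / 2 <= w j.
  move: lo; rewrite leq_eqVlt => /orP[/eqP/esym/w_mid->//|lo].
  by apply/ltW/w_hi => //; apply: leqW.
split.
  apply: le_lt_trans e_gt.
  have [_] := bP j ltac:(lia); rewrite /a.
  case: ifP => h1; first by lia.
  case: ifP => h2 /=; first exact: ltW.
  (* In this case [a j.+1] is r_j > w_j, too weak a bound; but b_j is now the middle root of f_D,
     equal to 1/2 = w_j by symmetry. *)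
  have ej : (j.*2 = n.+3)%N by lia.
  rewrite (w_mid j ej) => _.
  have := all_simple_roots_sym (root_sym (fD_sym _)) bS (i := j).
  rewrite (_ : n.+4.-1 - j = j)%N; last by lia.
  by move=> /(_ ltac:(lia)); lra.
have [B_lo B_hi] : w j < b j.+1 /\ b j.+1 < w j.+1.
  have [] := bP j.+1 ltac:(lia); have [] := wr j hi; rewrite /a.
  case: ifP => h1; first by lia.
  rewrite [X in _ -> _ -> _ -> (_ < X)%R -> _]ifF; last by lia.
  rewrite [X in _ -> _ -> _ -> (_ < X)%R -> _]ifT /=; last by lia.
  by case: ifP => h2 *; split; lra.
set B := b j.+1 in B_lo B_hi *.
have WB : 0 < (-1) ^+ j.+1 * (legendre_prim n.+2).[B].
  apply: (gap_sign wS (x := r j) (i := j.+1)) => //.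
  - by have [h1 h2] := wr j hi; apply: in_gap_consecutive => //; lia.
  - by apply: in_gap_consecutive => //; lia.
  - by lia.
  - by lia.
  exact: rW.
have fB : 0 < (-1) ^+ j.+1 * (fD_pos R n.+4).[B].
  have [_ _ _ rb] := bS; have /eqP := rb j.+1 ltac:(lia).
  rewrite -/B horner_fD horner_fD_pos.
  move: WB; move: ((-1) ^+ j.+1) (legendre_prim _).[B] (legendre _).[B].
  move=> s W P WB; rewrite -(natr1 n.+1) -(natr1 n) => e1.
  have B1 : 0 < 2 * B - 1 by lra.
  (* The positive factor 2B - 1 lets f_D(B) = 0 eliminate P without division. *)
  rewrite -(pmulr_rgt0 _ B1).
  have -> : (2 * B - 1)
      * (s * ((1 - B) ^+ 2 * P + ((n%:R + 1 + 3) * B - 2) * W))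
    = s * W * ((1 - B) ^+ 2 * (n%:R + 1 + 1)
               + (2 * B - 1) * ((n%:R + 1 + 3) * B - 2)).
    have e2 : (2 * B - 1) * P = (n%:R + 1 + 1) * W by lra.
    transitivity (s * (1 - B) ^+ 2 * ((2 * B - 1) * P)
      + (2 * B - 1) * s * ((n%:R + 1 + 3) * B - 2) * W); first by ring.
    by rewrite e2; ring.
  apply: mulr_gt0 => //.
  apply: ltr_wpDl; first by apply: mulr_ge0; [apply: sqr_ge0 | lra].
  by apply: mulr_gt0 => //; nra.
have [_ _ ince re] := eS.
(* If B < e_j, then B would share gap j of f_D^+ with w_j, where the sign is (-1)^j, against
   [fB]. *)
rewrite ltNge; apply/negP; rewrite le_eqVlt => /orP[/eqP eB|ltB].
  by move: fB; rewrite eB; have /eqP -> := re j ltac:(lia); rewrite mulr0 ltxx.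
have lo_e i : (i < j)%N -> e i < w j.
  move=> lt_ij; have hi' : (i <= n.+2)%N by lia.
  rewrite /e hi'; have [_ + _] := eP i hi'.
  rewrite /c (_ : (i < n.+2)%N); last by lia.
  by move/lt_le_trans; apply; apply: (increasing_upto_le incw); lia.
have : 0 < (-1) ^+ j * (fD_pos R n.+4).[B].
  apply: (gap_sign eS (x := w j) (i := j)); try lia.
  - by apply: in_gap_consecutive => // [|?]; [lia | apply: lo_e; lia].
  - apply: in_gap_consecutive => // [|?]; first by lia.
    by apply: lt_trans B_lo; apply: lo_e; lia.
  exact: fP.
by move: fB; rewrite exprS mulN1r mulNr; lra.
Qed.

End Legendre.

Theorem theorem8p14 (R : realType) (l nu : nat) :
  (5 <= l)%N -> (1 <= nu <= uphalf l - 1)%N ->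
  tD R l (uphalf l - nu) > tD_pos R l (uphalf l + 1 - nu)
  /\ tD_pos R l (uphalf l + 1 - nu) > tD R l (uphalf l + 1 - nu).
Proof.
move=> l5 /andP[nu1 nu2].
case: l l5 nu2 => [|[|[|[|n]]]] // _ nu2.
have [b [e [bS eS be]]] := fD_roots_interlace (R := R) n.
(* Rank k from the top is index l - k from the bottom. The bound 1 <= nu gives n + 3 <= 2j, and the
   upper bound on [nu] gives j <= n + 2. *)
pose j := (n.+4 - (uphalf n.+4 + 1 - nu))%N.
have up := uphalf_half n.+4; have od := odd_double_half n.+4.
have od1 : (odd n.+4 <= 1)%N by case: odd.
have -> : (uphalf n.+4 - nu = n.+4 - j.+1)%N by lia.
have -> : (uphalf n.+4 + 1 - nu = n.+4 - j)%N by lia.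
rewrite /tD /tD_pos !(nth_largest_root_all_simple bS); try lia.
rewrite (nth_largest_root_all_simple eS); last by lia.
by have [] := be j ltac:(lia) ltac:(lia).
Qed.
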